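(* Let $(a_n)_{n\ge 1}$ be a sequence of real numbers and let $D_a=\left\{z\in\mathbb{C}:\sum_{n=1}^{\infty}a_nz^n\text{ converges}\right\}$. If the characteristic equation $1-\sum_{n=1}^{\infty}a_nz^n=0$ has a root in $D_a\cap\{z\in\mathbb{C}:|z|<1\}$, then the null solution of the Volterra difference equation $x_n=\sum_{i=0}^{n-1}a_{n-i}x_i$, $n\ge 1$, is unstable.
   Context: A solution of the equation $x_n=\sum_{i=0}^{n-1}a_{n-i}x_i$ ($n\ge1$) is the sequence $(x_n)_{n\ge 0}$ generated recursively from an initial condition $x_0\in\mathbb{R}$. The null solution is the one with $x_0=0$. The null solution is stable if for every $\varepsilon>0$ there is $\delta>0$ such that $|x_0|<\delta$ implies $|x_n|<\varepsilon$ for all $n\ge 0$; it is unstable if it is not stable. No assumption is made on the radius of convergence of the power series $\sum_{n=1}^\infty a_nz^n$. *)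

(* Defs.v *)
From Stdlib Require Export Reals.
From Coquelicot Require Export Coquelicot.
Open Scope R_scope.

(* A sequence (a_n)_{n>=1} is encoded as [a : nat -> R]; the value [a 0] is
   a dummy that none of the definitions below reads. *)

Definition is_solution (a x : nat -> R) : Prop :=
  forall n : nat, (1 <= n)%nat ->
    x n = sum_f_R0 (fun i => a (n - i)%nat * x i) (n - 1).

(* A solution is determined by x_0, so quantifying over all solutions with
   |x_0| < delta is quantifying over all such initial conditions. *)
Definition null_solution_stable (a : nat -> R) : Prop :=
  forall eps : R, 0 < eps ->
    exists delta : R, 0 < delta /\
      forall x : nat -> R, is_solution a x ->
        Rabs (x 0%nat) < delta -> forall n : nat, Rabs (x n) < eps.

Definition null_solution_unstable (a : nat -> R) : Prop :=
  ~ null_solution_stable a.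

(* The summation index starts at 1, hence the shift by [S]. *)
Definition series_term (a : nat -> R) (z : C) (k : nat) : C :=
  (RtoC (a (S k)) * z ^ S k)%C.

Definition convergence_domain (a : nat -> R) (z : C) : Prop :=
  @ex_series C_AbsRing C_NormedModule (series_term a z).

(* Coquelicot has no total sum operator for complex series, so the value of
   the (convergent) series is passed through [is_series]. *)
Definition characteristic_root (a : nat -> R) (z : C) : Prop :=
  exists s : C, @is_series C_AbsRing C_NormedModule (series_term a z) s /\
    (RtoC 1 - s)%C = RtoC 0.

(* Main.v *)
Require Import Defs.
From Stdlib Require Import Reals Lra Lia.
From Coquelicot Require Import Coquelicot.
Open Scope R_scope.

(** Let [z] be a characteristic root with [Cmod z < 1], and let [T_k] be [1]
    minus the sum of the first [k] terms of the characteristic series, so that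
    [T_k] tends to [0].  For every solution [x], the equation says exactly that
    the convolution of [x_i * z^i] with [T_k] does not depend on the index:
    [sum_(i <= N) x_i * z^i * T_(N-i) = x_0] for all [N]
    ([char_remainder_convolution]).

    If the null solution were stable, some solution with [x_0 > 0] would satisfy
    [Rabs (x_n) < 1] for all [n].  The convolution is then dominated by that of
    the summable sequence [Cmod z ^ i] with the null sequence [Cmod (T_k)], so
    it cannot stay at distance [x_0] from [0]
    ([geometric_convolution_not_bounded_below]).

    Working with the partial sums [T_k] amounts to multiplying the generating
    functions of [a] and [x] at [z], but it only uses convergence of the
    characteristic series at [z], which may be conditional. *)

(** Course-of-values recursion: [solution_upto a x0 n] has the right values at
    all indices up to [n], so that the diagonal is the solution. *)
Fixpoint solution_upto (a : nat -> R) (x0 : R) (n : nat) : nat -> R :=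
  match n with
  | O => fun _ => x0
  | S m => fun k =>
      if Nat.leb k m then solution_upto a x0 m k
      else sum_f_R0 (fun i => a (S m - i)%nat * solution_upto a x0 m i) m
  end.

Lemma solution_upto_stable (a : nat -> R) (x0 : R) (n k : nat) :
  (k <= n)%nat -> solution_upto a x0 n k = solution_upto a x0 k k.
Proof.
  induction n as [|n IH]; intros Hk.
  - now replace k with 0%nat by lia.
  - destruct (Nat.eq_dec k (S n)) as [-> | Hne]; [reflexivity|].
    simpl. rewrite (proj2 (Nat.leb_le k n)) by lia. apply IH. lia.
Qed.

Lemma solution_exists (a : nat -> R) (x0 : R) :
  exists x : nat -> R, is_solution a x /\ x 0%nat = x0.
Proof.
  exists (fun n => solution_upto a x0 n n). split; [|reflexivity].
  intros [|n] Hn; [lia|].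
  replace (S n - 1)%nat with n by lia.
  cbn [solution_upto]. rewrite (proj2 (Nat.leb_gt (S n) n)) by lia.
  apply sum_eq. intros i Hi. now rewrite solution_upto_stable.
Qed.

Fixpoint char_remainder (a : nat -> R) (z : C) (k : nat) : C :=
  match k with
  | O => RtoC 1
  | S j => (char_remainder a z j - series_term a z j)%C
  end.

Lemma char_remainder_sum (a : nat -> R) (z : C) (k : nat) :
  char_remainder a z (S k) = (RtoC 1 - sum_n (series_term a z) k)%C.
Proof.
  induction k as [|k IH].
  - now rewrite sum_O.
  - rewrite sum_Sn.
    change (plus (sum_n (series_term a z) k) (series_term a z (S k)))
      with (sum_n (series_term a z) k + series_term a z (S k))%C.
    change (char_remainder a z (S (S k)))
      with (char_remainder a z (S k) - series_term a z (S k))%C.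
    rewrite IH. ring.
Qed.

Lemma char_remainder_cvg0 (a : nat -> R) (z : C) :
  characteristic_root a z ->
  forall eps : R, 0 < eps ->
    exists N, forall k, (N <= k)%nat -> Cmod (char_remainder a z k) < eps.
Proof.
  intros [s [Hs Hroot]] eps Heps.
  destruct (proj1 (filterlim_locally_ball_norm _ _) Hs (mkposreal eps Heps))
    as [N HN].
  exists (S N). intros [|k] Hk; [lia|].
  assert (Hball : Cmod (sum_n (series_term a z) k - s)%C < eps)
    by (apply HN; lia).
  rewrite char_remainder_sum.
  replace (RtoC 1 - sum_n (series_term a z) k)%C
    with ((RtoC 1 - s) - (sum_n (series_term a z) k - s))%C by ring.
  rewrite Hroot.
  replace (RtoC 0 - (sum_n (series_term a z) k - s))%C
    with (- (sum_n (series_term a z) k - s))%C by ring.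
  now rewrite Cmod_opp.
Qed.

Lemma RtoC_sum_f_R0 (u : nat -> R) (n : nat) :
  RtoC (sum_f_R0 u n) = sum_n (fun i => RtoC (u i)) n.
Proof.
  induction n as [|n IH].
  - now rewrite sum_O.
  - rewrite sum_Sn, <- IH. simpl. now rewrite RtoC_plus.
Qed.

(** Passing from [N] to [N + 1] changes the remainder paired with [x_i] by the
    term [a_(N+1-i) z^(N+1-i)], which subtracts [z^(N+1)] times the right-hand
    side of the Volterra equation, and adds the new summand [x_(N+1) z^(N+1)]:
    the two cancel. *)
Lemma char_remainder_convolution (a x : nat -> R) (z : C) (N : nat) :
  is_solution a x ->
  sum_n (fun i => (RtoC (x i) * z ^ i * char_remainder a z (N - i))%C) N
    = RtoC (x 0%nat).
Proof.
  intros Hx. induction N as [|N IH].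
  - rewrite sum_O. simpl. ring.
  - rewrite sum_Sn, Nat.sub_diag.
    rewrite (sum_n_ext_loc _
      (fun i => plus (RtoC (x i) * z ^ i * char_remainder a z (N - i))%C
                     (mult (- z ^ S N)%C (RtoC (a (S N - i)%nat * x i)%R))) N).
    + rewrite sum_n_plus, IH, (sum_n_mult_l (K := C_Ring)), <- RtoC_sum_f_R0.
      rewrite (Hx (S N)) by lia.
      replace (S N - 1)%nat with N by lia.
      change (RtoC (x 0%nat)
        + (- z ^ S N) * RtoC (sum_f_R0 (fun i => a (S N - i)%nat * x i)%R N)
        + RtoC (sum_f_R0 (fun i => a (S N - i)%nat * x i)%R N) * z ^ S N * RtoC 1
        = RtoC (x 0%nat))%C.
      ring.
    + intros i Hi.
      replace (S N - i)%nat with (S (N - i)) by lia.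
      change (RtoC (x i) * z ^ i
                * (char_remainder a z (N - i) - RtoC (a (S (N - i))) * z ^ S (N - i))
        = RtoC (x i) * z ^ i * char_remainder a z (N - i)
          + (- z ^ S N) * RtoC (a (S (N - i)) * x i)%R)%C.
      replace (S N) with (i + S (N - i))%nat at 1 by lia.
      rewrite Cpow_add_r, RtoC_mult. ring.
Qed.

(** The convolution [c_N] satisfies [c_(N+1) = q c_N + t_(N+1)].  If [c] stayed
    above [m > 0], then once [t_N] is below [(1 - q) m / 2] each step would
    decrease [c] by at least [(1 - q) m / 2], which cannot go on forever. *)
Lemma geometric_convolution_not_bounded_below (q m : R) (t : nat -> R) :
  q < 1 -> 0 < m ->
  (forall eps, 0 < eps -> exists N, forall k, (N <= k)%nat -> t k < eps) ->
  ~ (forall N, m <= sum_f_R0 (fun i => q ^ i * t (N - i)%nat) N).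
Proof.
  intros Hq Hm Ht Hlow.
  set (c := fun N => sum_f_R0 (fun i => q ^ i * t (N - i)%nat) N) in *.
  assert (Hrec : forall N, c (S N) = q * c N + t (S N)).
  { intros N. unfold c. rewrite decomp_sum by lia. simpl pred.
    rewrite scal_sum, Nat.sub_0_r, pow_O, Rplus_comm.
    f_equal; [|ring]. apply sum_eq. intros i _. simpl. ring. }
  set (d := (1 - q) * m / 2).
  assert (Hd : 0 < d) by (unfold d; nra).
  destruct (Ht d Hd) as [N HN].
  assert (Hdecr : forall k, c (N + k)%nat <= c N - INR k * d).
  { induction k as [|k IH].
    - rewrite Nat.add_0_r. simpl. lra.
    - rewrite Nat.add_succ_r, Hrec, S_INR.
      specialize (HN (S (N + k)) ltac:(lia)).
      specialize (Hlow (N + k)%nat). change (m <= c (N + k)%nat) in Hlow.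
      assert ((1 - q) * m <= (1 - q) * c (N + k)%nat) by nra.
      unfold d in *. lra. }
  destruct (INR_unbounded (c N / d)) as [k Hk].
  assert (c N < INR k * d).
  { apply (Rmult_lt_compat_r d) in Hk; [|exact Hd].
    unfold Rdiv in Hk. rewrite Rmult_assoc, Rinv_l in Hk by lra. lra. }
  specialize (Hdecr k). specialize (Hlow (N + k)%nat).
  change (m <= c (N + k)%nat) in Hlow. lra.
Qed.

Lemma bounded_solution_convolution_bound (a x : nat -> R) (z : C) (N : nat) :
  is_solution a x -> (forall n, Rabs (x n) <= 1) ->
  Rabs (x 0%nat)
    <= sum_f_R0 (fun i => Cmod z ^ i * Cmod (char_remainder a z (N - i))) N.
Proof.
  intros Hx Hbound.
  rewrite <- Cmod_R, <- (char_remainder_convolution a x z N Hx), <- sum_n_Reals.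
  eapply Rle_trans; [apply (norm_sum_n_m (K := C_AbsRing) (V := C_NormedModule))|].
  apply sum_n_m_le. intros i.
  change (Cmod (RtoC (x i) * z ^ i * char_remainder a z (N - i))
    <= Cmod z ^ i * Cmod (char_remainder a z (N - i))).
  rewrite !Cmod_mult, Cmod_R, Cmod_pow, Rmult_assoc.
  rewrite <- (Rmult_1_l (Cmod z ^ i * _)) at 2.
  apply Rmult_le_compat_r; [|apply Hbound].
  apply Rmult_le_pos; [apply pow_le|]; apply Cmod_ge_0.
Qed.

Theorem theorem6 (a : nat -> R)
  (hroot : exists z : C, convergence_domain a z /\ Cmod z < 1 /\ characteristic_root a z) :
  null_solution_unstable a.
Proof.
  destruct hroot as [z [_ [Hz Hroot]]]. intros Hstable.
  destruct (Hstable 1 Rlt_0_1) as [delta [Hdelta Hsmall]].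
  destruct (solution_exists a (delta / 2)) as [x [Hx Hx0]].
  assert (Habs : Rabs (x 0%nat) = delta / 2)
    by (rewrite Hx0; apply Rabs_pos_eq; lra).
  apply (geometric_convolution_not_bounded_below (Cmod z) (delta / 2)
           (fun k => Cmod (char_remainder a z k))); [exact Hz | lra | |].
  - now apply char_remainder_cvg0.
  - intros N. rewrite <- Habs.
    apply bounded_solution_convolution_bound; [exact Hx|].
    intros n. apply Rlt_le, Hsmall; [exact Hx | lra].
Qed.
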